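(* Let $I=\{1,\dots,n\}$. For each $i\in I$ let $X_i$ be a nonempty compact convex subset of a real Hausdorff locally convex space, let $X=\prod_{i\in I}X_i$, let $S_i,Q_i:X\to 2^{X_i}$ be set-valued maps with nonempty values, and let $R_i(x,y_i)$ be a relation linking $x\in X$ and $y_i\in X_i$. Suppose that, for each $i\in I$: (H1) for any fixed $x_j\in X_j$, $j\neq i$, there exists $\bar x_i\in X_i$ such that $\bar x_i\in S_i(x_1,\dots,\bar x_i,\dots,x_n)$ and $R_i(x_1,\dots,\bar x_i,\dots,x_n,y_i)$ holds for all $y_i\in Q_i(x_1,\dots,\bar x_i,\dots,x_n)$; (H2) for any fixed $x_j\in X_j$, $j\neq i$, the set $\{z_i\in X_i \mid z_i\in S_i(x_1,\dots,x_{i-1},z_i,x_{i+1},\dots,x_n)\}$ is convex; (H3) for any fixed $x_j\in X_j$, $j\neq i$, and any finitely many points $z_i^1,\dots,z_i^l\in X_i$: if for every $k\in\{1,\dots,l\}$ the relation $R_i(x_1,\dots,z_i^k,\dots,x_n,t_i^k)$ holds for every $t_i^k\in Q_i(x_1,\dots,z_i^k,\dots,x_n)$, then $R_i(x_1,\dots,z_i,\dots,x_n,\theta_i)$ holds for every $z_i\in\mathrm{co}\{z_i^1,\dots,z_i^l\}$ and every $\theta_i\in Q_i(x_1,\dots,z_i,\dots,x_n)$; (H4) for every net $(x^\alpha)_{\alpha\in A}$ in $X$, $x^\alpha=(x_1^\alpha,\dots,x_n^\alpha)$, with $x^\alpha\to x^0=(x_1^0,\dots,x_n^0)\in X$, if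 $x_i^\alpha\in S_i(x^\alpha)$ for every $\alpha\in A$, then $x_i^0\in S_i(x^0)$; (H5) for every net $(x^\alpha)_{\alpha\in A}$ in $X$ with $x^\alpha\to x^0\in X$, if for every $\alpha\in A$ the relation $R_i(x^\alpha,t_i)$ holds for every $t_i\in Q_i(x^\alpha)$, then $R_i(x^0,\theta_i)$ holds for every $\theta_i\in Q_i(x^0)$. Then there exists $\bar x=(\bar x_1,\dots,\bar x_n)\in X$ such that for each $i\in I$, $\bar x_i\in S_i(\bar x)$ and $R_i(\bar x,y_i)$ holds for all $y_i\in Q_i(\bar x)$.
   Context: A relation $R_i(x,y_i)$ linking $x\in X$ and $y_i\in X_i$ is an arbitrary predicate on $X\times X_i$ (equivalently a subset of $X\times X_i$). $2^{X_i}$ denotes the set of all subsets of $X_i$. $X$ carries the product topology. $\mathrm{co}\,A$ denotes the convex hull of $A$. When $x_j\in X_j$ are fixed for $j\neq i$ and $z\in X_i$, the notation $(x_1,\dots,z,\dots,x_n)$ means $(x_1,\dots,x_{i-1},z,x_{i+1},\dots,x_n)$, i.e. $z$ is in the $i$-th position. The locally convex spaces containing the sets $X_i$ may differ for different $i$. *)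

(* Defs.v *)
From mathcomp Require Import all_boot all_order all_algebra.
From mathcomp Require Import all_classical all_reals all_analysis.

Set Implicit Arguments.
Unset Strict Implicit.
Unset Printing Implicit Defensive.

Local Open Scope classical_set_scope.

Record directed_set (A : Type) (le : A -> A -> Prop) : Prop := DirectedSet {
  directed_inhabited : inhabited A;
  directed_refl : forall a, le a a;
  directed_trans : forall a b c, le a b -> le b c -> le a c;
  directed_ub : forall a b, exists c, le a c /\ le b c }.

(* The eventuality filter, generated by the tails [set b | le a b]: a net
   x : A -> T converges to x0 iff x @ tails le --> x0. *)
Definition tails (A : Type) (le : A -> A -> Prop) : set_system A :=
  filter_from [set: A] (fun a => [set b | le a b]).

Definition convex_hull (R : numDomainType) (M : lmodType R) (A : set M) :
    set M :=
  smallest (@convex_set R M) A.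

(* Main.v *)
Require Import Defs.
From mathcomp Require Import all_boot zify.

(** The sets G_i(x) of those z in X_i that satisfy (H1) in position i are
nonempty and convex, and (H4), (H5) make their graphs closed, so what is needed
is a Kakutani-Fan-Glicksberg fixed point of x |-> prod_i G_i(x).

The fixed point comes from Scarf's lemma. Given neighbourhoods V_i of 0, cover
X by finitely many translates x^k + V, choose y^k in prod_i G_i(x^k), and colour
each point a of a fine grid on the standard simplex by some k such that
sum_j a_j y^j is V-close to x^k. Scarf's lemma yields a set J of colours and
grid points of every colour in J that are all close to one point b of the face
spanned by J; thus b = sum_j b_j y^j is a convex combination of the y^j, j in J,
while x^j is close to b for j in J. Letting V shrink, compactness of X and upper
semicontinuity of the G_i produce a fixed point. *)

Set Implicit Arguments.
Unset Strict Implicit.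
Unset Printing Implicit Defensive.

(** * Scarf's lemma *)

Lemma odd_sum_card (I : finType) (P : pred I) (F : I -> nat) :
  odd (\sum_(i | P i) F i) = odd #|[pred i | P i & odd (F i)]|.
Proof.
rewrite -sum1_card big_mkcondr /=.
by elim/big_rec2: _ => // i a b _ e; rewrite !oddD e; case: (odd (F i)).
Qed.

Section Scarf.
Variables (m : nat) (U : finType) (w : 'I_m.+2 -> U -> nat).
Hypothesis w_inj : forall i, injective (w i).
Implicit Types (D P : {set U}) (i j k l : 'I_m.+2).

Definition above P i y := [exists z in P, w i z < w i y].
(** Dominant sets act as the simplices of a triangulation: those with [m.+2] elements are its cells,
    those with [m.+1] elements their facets. *)
Definition dominant P := [forall y, ~~ [forall i, above P i y]].
Definition minimum P i z := (z \in P) && ~~ above P i z.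
(** Only the order [k] can keep such a [y] from refuting the dominance of [D]. *)
Definition free D k : {set U} := [set y | [forall (l | l != k), above D l y]].

Lemma aboveP P i y : reflect (exists2 z, z \in P & w i z < w i y) (above P i y).
Proof. exact: exists_inP. Qed.

Lemma dominantP P : reflect (forall y, exists i, ~~ above P i y) (dominant P).
Proof.
apply: (iffP forallP) => h y; first by have /forallPn := h y.
by apply/forallPn; exact: h.
Qed.

Lemma sub_dominant D P : D \subset P -> dominant P -> dominant D.
Proof.
move=> DP /dominantP h; apply/dominantP => y; have [i hi] := h y; exists i.
apply: contra hi => /aboveP[z zD zy]; apply/aboveP; exists z => //.
exact: (subsetP DP).
Qed.

Lemma freeP D k y : reflect (forall l, l != k -> above D l y) (y \in free D k).
Proof. by rewrite inE; apply: (iffP forall_inP). Qed.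

Lemma minimum_above P i z y : minimum P i z -> above P i y = (w i z < w i y).
Proof.
case/andP=> zP /aboveP zmin; apply/aboveP/idP => [[x xP xy]|zy]; last by exists z.
by apply: leq_ltn_trans xy; rewrite leqNgt; apply/negP => xz; apply: zmin; exists x.
Qed.

Lemma minimum_uniq P i z z' : minimum P i z -> minimum P i z' -> z = z'.
Proof.
move=> hz hz'; apply: (@w_inj i); apply/eqP; rewrite eqn_leq; apply/andP.
have /andP[_ zN] := hz; have /andP[_ z'N] := hz'.
by split; rewrite leqNgt -?(minimum_above z' hz) -?(minimum_above z hz').
Qed.

(** A common element would be above [P] in every order. *)
Lemma dominant_free P k k' : k != k' -> dominant P -> [disjoint free P k & free P k'].
Proof.
move=> kk' /dominantP dP; apply/pred0P => y /=; apply/negP => /andP[/freeP yk /freeP yk'].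
have [l /negP] := dP y; apply.
by have [lk|/yk//] := eqVneq l k; apply: yk'; rewrite lk.
Qed.

Lemma card_free_top D k :
  #|[set x in free D k | [forall y in free D k, w k y <= w k x]]| =
  (free D k != set0).
Proof.
have [-> | [x0 x0F]] := set_0Vmem (free D k).
  by rewrite eqxx; apply: eq_card0 => x; rewrite !inE.
have -> : free D k != set0 by apply/set0Pn; exists x0.
apply/eqP/cards1P.
case: (arg_maxnP (w k) x0F) => x xF xmax; exists x; apply/setP => y; rewrite in_set1 inE.
apply/andP/eqP => [[yF /forall_inP ymax]|->]; last first.
  by split => //; apply/forall_inP => y' /xmax.
by apply: (@w_inj k); apply/eqP; rewrite eqn_leq ymax// andbT; exact: xmax.
Qed.

Lemma exists_minimum D i : D != set0 -> exists z, minimum D i z.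
Proof.
case/set0Pn=> x0 x0D; case: (arg_minnP (w i) x0D) => z zD zmin; exists z.
apply/andP; split => //; apply/aboveP => -[x xD]; rewrite ltnNge => /negP; apply.
exact: zmin.
Qed.

(* By dominance each z in D is the minimum of D in some order; as there is one
   more order than elements, exactly two orders i, j share their minimum. A new
   element x can only become the minimum of x |: D in the order i or j, and it
   is then the largest element of free D i, resp. free D j, in that order. *)
Lemma card_rooms D : #|D| = m.+1 -> dominant D ->
  exists i j, [/\ i != j, exists2 z, minimum D i z & minimum D j z &
   #|[set x in ~: D | dominant (x |: D)]| = (free D i != set0) + (free D j != set0)].
Proof.
move=> cD dD; have D0 : D != set0 by rewrite -card_gt0 cD.
have cD1 k : #|setT :\ k| = m.+1.
  by have := cardsD1 k setT; rewrite inE cardsT card_ord add1n => -[].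
have /fin_all_exists[mu muP] := fun i => exists_minimum i D0.
have muD i : mu i \in D by have /andP[] := muP i.
have mu_onto (A : {set 'I_m.+2}) : (forall z, z \in D -> exists2 l, l \in A & minimum D l z) ->
    mu @: A = D.
  move=> h; apply/setP => z; apply/imsetP/idP => [[l _ ->]//|/h[l lA zl]].
  by exists l => //; apply: minimum_uniq zl _.
have muT : mu @: setT = D.
  apply: mu_onto => z zD; have [l zl] := dominantP _ dD z; exists l => //.
  by rewrite /minimum zD.
have /injectivePn [i [j ij muij]] : ~~ injectiveb mu.
  apply/negP => /injectiveP /(@card_imset _ _ mu setT); rewrite muT cD cardsT card_ord.
  by move/eqP; rewrite eqn_leq ltnn andbF.
have muD1 k : k = i \/ k = j -> mu @: (setT :\ k) = D.
  move=> kij; apply: mu_onto => z; rewrite -{1}muT => /imsetP[l _ ->].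
  have [lk|lk] := eqVneq l k; last by exists l; rewrite ?inE ?lk.
  case: kij lk => -> ->; [exists j|exists i] => //; rewrite ?inE ?andbT.
  - by rewrite eq_sym.
  - by rewrite muij.
  - by [].
  - by rewrite -muij.
pose top k := [set x in free D k | [forall y in free D k, w k y <= w k x]].
exists i, j; split => //; first by exists (mu i) => //; rewrite muij.
have -> : [set x in ~: D | dominant (x |: D)] = top i :|: top j.
  apply/setP => x; rewrite in_setU inE in_setC.
  apply/idP/idP.
    case/andP=> xD dx.
    have [k xk] := dominantP _ dD x.
    (* Every [z] in [D] is still the minimum of [x |: D] in some order, and there [x] is above [D].
       So [mu] maps [A] onto [D], and only [k] can be outside [A]. *)
    pose A := [set l | above D l x].
    have cA : mu @: A = D.
      apply: mu_onto => z zD.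
      have [l zl] := dominantP _ dx z.
      have zminl : minimum D l z.
        rewrite /minimum zD; apply: contra zl => /aboveP[y yD yz].
        by apply/aboveP; exists y; rewrite // in_setU1 yD orbT.
      exists l => //; rewrite inE (minimum_above _ zminl) ltn_neqAle.
      rewrite (inj_eq (@w_inj l)) leqNgt; apply/andP; split.
        by apply: contraNneq xD => <-.
      apply: contra zl => xz; apply/aboveP; exists x => //.
      by rewrite setU11.
    have kA : k \notin A by rewrite inE.
    have AE : A = setT :\ k.
      apply/eqP; rewrite eqEcard; apply/andP; split.
        by apply/subsetP => l lA; rewrite !inE andbT; apply: contraNneq kA => <-.
      have := leq_imset_card mu A; rewrite cA cD; apply: leq_trans.
      by rewrite cD1.
    have injA : {in A &, injective mu}.
      by apply/imset_injP; rewrite cA cD AE cD1.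
    have xF : x \in free D k.
      apply/freeP => l lk; suff : l \in A by rewrite inE.
      by rewrite AE !inE lk.
    (* A larger free element would be above [x |: D] in every order. *)
    have xtop : x \in top k.
      rewrite inE xF; apply/forall_inP => y /freeP yF; rewrite leqNgt; apply/negP => xy.
      have [l /negP] := dominantP _ dx y; apply; apply/aboveP.
      have [->|/yF /aboveP[z zD zy]] := eqVneq l k; first by exists x => //; rewrite setU11.
      by exists z => //; rewrite in_setU1 zD orbT.
    suff : (k == i) || (k == j).
      by case/orP=> /eqP <-; rewrite xtop ?orbT.
    apply/negPn/negP; rewrite negb_or => /andP[ki kj].
    by move/eqP: ij; apply; apply: injA; rewrite ?AE ?inE ?andbT // eq_sym.
  move=> h; have {h} [k [kij xtop]] : exists k, (k = i \/ k = j) /\ x \in top k.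
    by case/orP: h => h; [exists i|exists j]; split=> //; [left|right].
  have := xtop; rewrite inE => /andP[xF /forall_inP xmax].
  have /freeP xF' := xF.
  apply/andP; split.
    apply/negP; rewrite -{1}(muD1 k kij) => /imsetP[l]; rewrite !inE andbT => lk xl.
    by have := xF' _ lk; rewrite (minimum_above _ (muP l)) xl ltnn.
  apply/dominantP => y; have [l yl] := dominantP _ dD y.
  case: (boolP [forall l', above (x |: D) l' y]) => [/forallP ally|/forallPn//].
  exfalso.
  (* As [x] is above [D] in the orders other than [k], so is [y]. By dominance of [D], only [x] can
     then be below [y] in the order [k], against the maximality of [x]. *)
  have yF : y \in free D k.
    apply/freeP => l' l'k; have /aboveP[z] := ally l'.
    rewrite in_setU1 => /predU1P[->{z} xy|zD zy]; last by apply/aboveP; exists z.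
    by have /aboveP[z zD zx] := xF' _ l'k; apply/aboveP; exists z => //; apply: ltn_trans xy.
  have [lk|lk] := eqVneq l k; last by move/negP: yl; apply; move/freeP: yF => ->.
  have /aboveP[z] := ally k; rewrite in_setU1 => /predU1P[->|zD zy].
    by rewrite ltnNge xmax.
  by move/aboveP: yl; apply; rewrite lk; exists z.
rewrite cardsU -!card_free_top -/(top i) -/(top j).
suff -> : top i :&: top j = set0 by rewrite cards0 subn0.
apply/setP => x; rewrite in_setI in_set0; apply/negP => /andP[].
rewrite inE => /andP[xi _]; rewrite inE => /andP[xj _].
have /pred0P/(_ x) := dominant_free ij dD.
by rewrite /= xi xj.
Qed.


Variables (col : U -> 'I_m.+2) (i0 : 'I_m.+2).

(** Cells and facets in the parity proof of Sperner's lemma; a door carries each colour other than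
    [i0] exactly once. *)
Definition room P := (#|P| == m.+2) && dominant P.
Definition door D := [&& #|D| == m.+1, dominant D & col @: D == [set~ i0]].

Lemma card_setC1_ord i : #|[set~ i]| = m.+1.
Proof. by have := cardsC1 i; rewrite card_ord. Qed.

(** A rainbow room has one door, got by deleting its element of colour [i0]. Any other room has none
    or two: if deleting [x] leaves a door, exactly one other element [x'] has the colour of [x], and
    deleting [x'] leaves the second door. *)
Lemma odd_doors_of_room P : room P ->
  odd #|[set D | door D && (D \subset P)]| = (col @: P == setT).
Proof.
case/andP=> /eqP cP dP.
have -> : [set D | door D && (D \subset P)] =
    (fun x => P :\ x) @: [set x in P | col @: (P :\ x) == [set~ i0]].
  apply/setP => D; rewrite inE; apply/idP/imsetP.
    case/andP=> /and3P[/eqP cD dD colD] DP.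
    have /cards1P[x xE] : #|P :\: D| == 1.
      by rewrite cardsD (setIidPr DP) cP cD subSn ?subnn.
    have xPD : x \in P :\: D by rewrite xE set11.
    have DE : D = P :\ x by rewrite -xE setDDr setDv set0U (setIidPr DP).
    by exists x => //; rewrite inE -DE colD andbT; case/setDP: xPD.
  case=> x; rewrite inE => /andP[xP colx] ->; rewrite subD1set andbT /door colx.
  rewrite (sub_dominant (subD1set _ _) dP) !andbT.
  by have := cardsD1 x P; rewrite xP cP add1n => -[->].
rewrite card_in_imset; last first.
  move=> x y /[!inE] /andP[xP _] /andP[yP _] /setP/(_ x); rewrite !inE eqxx xP andbT /=.
  by case: eqVneq.
have [colP|colP] := eqVneq (col @: P) setT.
  have injP : {in P &, injective col}.
    by apply/imset_injP; rewrite colP cP cardsT card_ord.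
  have : i0 \in col @: P by rewrite colP inE.
  case/imsetP => x xP i0E.
  rewrite (_ : [set _ in _ | _] = [set x]) ?cards1//.
  apply/setP => y; rewrite inE in_set1; apply/andP/eqP => [[yP /eqP colPy]|->].
    apply/eqP/negPn/negP => yx; have : i0 \in col @: (P :\ y).
      by rewrite i0E; apply/imset_f; rewrite !inE eq_sym yx.
    by rewrite colPy !inE eqxx.
  split=> //; apply/eqP/setP => i; rewrite !inE; apply/imsetP/idP.
    case=> z; rewrite !inE => /andP[zx zP] ->; rewrite i0E.
    by apply: contra zx => /eqP/injP ->.
  have : i \in col @: P by rewrite colP inE.
  case/imsetP => z zP -> zi0; exists z => //; rewrite !inE zP andbT.
  by apply: contraNneq zi0 => ->; rewrite i0E.
have [-> | [x]] := set_0Vmem [set x in P | col @: (P :\ x) == [set~ i0]].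
  by rewrite cards0.
rewrite inE => /andP[xP /eqP colx].
have cPx : #|P :\ x| = m.+1 by have := cardsD1 x P; rewrite xP cP add1n => -[<-].
have injx : {in P :\ x &, injective col}.
  by apply/imset_injP; rewrite colx cPx card_setC1_ord.
have colxi0 : col x != i0.
  apply: contraNneq colP => colxE; rewrite -subTset; apply/subsetP => i _.
  have [->|ii0] := eqVneq i i0; first by rewrite -colxE imset_f.
  have : i \in col @: (P :\ x) by rewrite colx !inE.
  by apply/subsetP/imsetS/subD1set.
have : col x \in col @: (P :\ x) by rewrite colx !inE.
case/imsetP => x'; rewrite !inE => /andP[x'x x'P] colxx'.
rewrite (_ : [set _ in _ | _] = [set x; x']) ?cards2 1?eq_sym ?x'x//.
have aux y : y \in P -> y != x -> y != x' -> col @: (P :\ y) = col @: (P :\ x) -> False.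
  move=> yP yx yx' e.
  have : col y \in col @: (P :\ y) by rewrite e imset_f// !inE yx.
  case/imsetP => z; rewrite !inE => /andP[zy zP] yz.
  have [zx|zx] := eqVneq z x.
    move/eqP: yx'; apply; apply: injx; rewrite ?inE ?yx ?x'x //.
    by rewrite yz zx.
  by move/eqP: zy; apply; apply: injx; rewrite ?inE ?yx ?zx.
apply/setP => y; rewrite inE in_set2; apply/andP/orP.
  case=> yP /eqP coly.
  have [yx|yx] := eqVneq y x; first by left.
  have [yx'|yx'] := eqVneq y x'; first by right.
  by case: (@aux y) => //; rewrite coly.
case=> /eqP ->; first by rewrite xP colx.
split=> //; rewrite -colx; apply/eqP/setP => i; apply/imsetP/imsetP.
  case=> z; rewrite !inE => /andP[zx' zP] ->.
  have [->|zx] := eqVneq z x; first by exists x'; rewrite ?inE ?x'x.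
  by exists z; rewrite ?inE ?zx.
case=> z; rewrite !inE => /andP[zx zP] ->.
have [->|zx'] := eqVneq z x'; last by exists z; rewrite ?inE ?zx'.
by exists x; rewrite ?inE ?xP 1?eq_sym ?x'x.
Qed.

Lemma card_rooms_of_door D : door D ->
  #|[set P | room P && (D \subset P)]| = #|[set x in ~: D | dominant (x |: D)]|.
Proof.
case/and3P=> /eqP cD dD _.
have -> : [set P | room P && (D \subset P)] =
    (fun x => x |: D) @: [set x in ~: D | dominant (x |: D)].
  apply/setP => P; rewrite inE; apply/idP/imsetP.
    case/andP=> /andP[/eqP cP dP] DP.
    have /cards1P[x xE] : #|P :\: D| == 1.
      by rewrite cardsD (setIidPr DP) cP cD subSn ?subnn.
    have /setDP[xP xD] : x \in P :\: D by rewrite xE set11.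
    have PE : P = x |: D by rewrite -xE setUC -{1}(setID P D) (setIidPr DP).
    by exists x => //; rewrite !inE xD -PE.
  case=> x; rewrite !inE => /andP[xD dx] ->; rewrite subsetUr andbT /room dx andbT.
  by rewrite cardsU1 xD cD.
rewrite card_in_imset // => x y; rewrite !inE => /andP[xD _] /andP[yD _].
by move/setP/(_ x); rewrite !inE eqxx (negPf xD) orbF; case: eqVneq.
Qed.

(* Double counting of incident (door, room) pairs, modulo 2. *)
Lemma odd_rainbow_rooms :
  odd #|[set P | room P && (col @: P == setT)]| =
  odd #|[set D | door D && odd #|[set x in ~: D | dominant (x |: D)]|]|.
Proof.
have -> : [set P | room P && (col @: P == setT)] =
    [set P | room P && odd #|[set D | door D && (D \subset P)]|].
  by apply/setP => P; rewrite !inE; apply: andb_id2l => /odd_doors_of_room ->.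
have -> : [set D | door D && odd #|[set x in ~: D | dominant (x |: D)]|] =
    [set D | door D && odd #|[set P | room P && (D \subset P)]|].
  by apply/setP => D; rewrite !inE; apply: andb_id2l => /card_rooms_of_door ->.
rewrite !cardsE -!odd_sum_card; congr odd.
under eq_bigr do rewrite -sum1_card.
under [RHS]eq_bigr do rewrite -sum1_card.
rewrite (exchange_big_dep door) => [|P D _]/=; last by rewrite inE => /andP[].
apply: eq_bigr => D dD; apply: eq_bigl => P.
by rewrite !inE dD.
Qed.

End Scarf.

Theorem scarf (m : nat) (T : finType) (t0 : T) (v : 'I_m.+2 -> T -> nat) (c : T -> 'I_m.+2) :
  (forall i, injective (v i)) ->
  exists s : {set T}, forall y, exists2 i, i \in c @: s & forall x, x \in s -> v i y <= v i x.
Proof.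
(* A slack element inr k is the least element in the order k and exceeds all of
   T in the other orders; it stands for colour k being unused. *)
move=> v_inj; pose U := (T + 'I_m.+2)%type.
(* The values on [T] are shifted by one to keep 0 for [inr i]; [B] exceeds all shifted values. *)
pose B := (\max_i \max_t v i t).+2.
have vB i t : (v i t).+1 < B.
  by rewrite !ltnS; apply: leq_trans (leq_bigmax i); apply: (leq_bigmax t).
pose w (i : 'I_m.+2) (u : U) := match u with
  | inl t => (v i t).+1
  | inr k => if k == i then 0 else B + k end.
have w_inj i : injective (w i).
  move=> [t|k] [t'|k'] /=.
  - by move=> [/v_inj ->].
  - by have := vB i t; case: ifP => // _; lia.
  - by have := vB i t'; case: ifP => // _; lia.
  have [->|ki] := eqVneq k i; have [->|k'i] := eqVneq k' i; [by []|lia|lia|].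
  by move/addnI/val_inj ->.
pose col (u : U) := match u with inl t => c t | inr k => k end.
pose outer : {set U} := inr @: [set~ ord0].
have wi i : w i (inr i) = 0 by rewrite /= eqxx.
have slack_above (D : {set U}) k l t : inl t \in D -> l != k -> above w D l (inr k).
  move=> tD lk; apply/aboveP; exists (inl t) => //=; rewrite eq_sym (negPf lk).
  by have := vB l t; lia.
have slack_min (D : {set U}) i y : minimum w D i y -> inr i \in D -> y = inr i.
  case/andP=> _ /aboveP ymin iD; apply: (@w_inj i); rewrite wi.
  by case E: (w i y) => [//|n]; case: ymin; exists (inr i); rewrite // wi E.
have outerP k : (inr k \in outer) = (k != ord0).
  by rewrite mem_imset ?inE //; apply: inr_inj.
have rooms_outer i z : i != ord0 -> minimum w outer i z -> minimum w outer ord0 z ->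
    (free w outer i = set0) * (free w outer ord0 != set0).
  move=> i0 zi z0; split; last first.
    apply/set0Pn; exists (inl t0); apply/freeP => l l0; apply/aboveP.
    by exists (inr l); rewrite ?outerP // wi.
  have zE : z = inr i by apply: slack_min zi _; rewrite outerP.
  apply/setP => y; rewrite in_set0; apply/negP => /freeP yF.
  have := yF ord0; rewrite eq_sym => /(_ i0); rewrite (minimum_above _ z0) zE.
  case: y yF => [t _|r yF].
    by rewrite /= (negPf i0) => h; have := vB ord0 t; lia.
  have [->|ri] := eqVneq r i; first by rewrite ltnn.
  by have /aboveP[x _] := yF r ri; rewrite wi.
(* The only door in an odd number of rooms is [outer]. A door with an element of [T] lies in two
   rooms, since [inr k] is free for each order [k]; a door of slack elements only is [outer], which
   lies in one room. *)
have [P PP] : exists P, P \in [set P | room w P && (col @: P == setT)].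
  apply/set0Pn; rewrite -card_gt0; apply: odd_gt0; rewrite (odd_rainbow_rooms _ _ ord0) //.
  rewrite (_ : [set _ | _] = [set outer]) ?cards1//.
  apply/setP => D; rewrite inE in_set1; apply/andP/eqP => [[dD oD]|->].
    have /and3P[/eqP cD dmD /eqP colD] := dD.
    have [i [j [ij _ cE]]] := card_rooms w_inj cD dmD.
    apply/eqP; rewrite eqEcard card_imset; last exact: inr_inj.
    rewrite cD card_setC1_ord leqnn andbT; apply/subsetP => -[t tD|k kD]; last first.
      by rewrite outerP; have := imset_f col kD; rewrite colD !inE.
    move: oD; rewrite cE.
    suff F k : free w D k != set0 by rewrite !F.
    by apply/set0Pn; exists (inr k); apply/freeP => l; apply: slack_above tD.
  have cO : #|outer| = m.+1 by rewrite card_imset ?card_setC1_ord //; apply: inr_inj.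
  have dO : dominant w outer.
    apply/dominantP => -[t|k]; [exists ord0|exists k]; apply/aboveP => -[x xO].
      move: xO => /imsetP[k]; rewrite !inE => k0 -> /=.
      by rewrite (negPf k0); have := vB ord0 t; lia.
    by rewrite wi.
  split.
    rewrite /door cO eqxx dO; apply/eqP/setP => k; rewrite in_setC1.
    apply/imsetP/idP => [[_ /imsetP[l l0 ->] ->]|k0]; first by rewrite !inE in l0.
    by exists (inr k); rewrite ?outerP.
  have [i [j [ij [z zi zj] ->]]] := card_rooms w_inj cO dO.
  have [i0|i0] := eqVneq i ord0.
    have j0 : j != ord0 by rewrite eq_sym -i0.
    by rewrite i0 in zi *; have [-> ->] := rooms_outer j z j0 zj zi; rewrite eqxx.
  have [j0|j0] := eqVneq j ord0.
    by rewrite j0 in zj *; have [-> ->] := rooms_outer i z i0 zi zj; rewrite eqxx.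
  case/eqP: ij; apply: (@inr_inj T).
  by rewrite -(slack_min _ _ _ zi) ?outerP // -(slack_min _ _ _ zj) ?outerP.
move: PP; rewrite inE => /andP[/andP[_ /dominantP dP] /eqP colP].
exists [set t | inl t \in P] => y; have [i iN] := dP (inl y).
(* In the order [i] the slack element [inr i] is below [inl y], so it is not in [P], and the colour
   [i] comes from an element of [T]. *)
have iP : inr i \notin P by apply: contra iN => iP; apply/aboveP; exists (inr i); rewrite ?wi.
exists i; last first.
  move=> x; rewrite inE => xP; rewrite leqNgt; apply: contra iN => xy; apply/aboveP.
  by exists (inl x).
have : i \in col @: P by rewrite colP inE.
case/imsetP => -[t tP ->|k kP /= ik]; last by rewrite ik kP in iP.
by apply: imset_f; rewrite inE.
Qed.

(** * Colourings of the grid on a simplex *)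

Lemma fill_simplex (n N : nat) (J : {set 'I_n}) (f : 'I_n -> nat) :
  J != set0 -> \sum_(j in J) f j <= N ->
  exists g : 'I_n -> nat, [/\ \sum_j g j = N, forall j, j \notin J -> g j = 0 &
    forall j, j \in J -> f j <= g j <= f j + (N - \sum_(j in J) f j)].
Proof.
case/set0Pn=> j0 j0J fN; set r := N - _.
exists (fun j => if j \in J then f j + (if j == j0 then r else 0) else 0); split.
- rewrite -big_mkcond /= big_split /= [X in _ + X](bigD1 j0) //= eqxx.
  by rewrite [X in _ + (_ + X)]big1 => [|j /andP[_ /negPf->]//]; rewrite addn0 subnKC.
- by move=> j /negPf ->.
- by move=> j ->; rewrite leq_addr leq_add2l /=; case: ifP.
Qed.

(** Scarf's lemma is applied to the coordinate orders. Let [f] be the coordinatewise minimum over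
    the set [s] it yields, and [J] the colours of [s]. On [J] the sum of [f] falls short of [N] by
    less than [m.+2]; filling this deficit gives [b]. The points of [s] dominate [f], so the deficit
    bounds their excess over [f] on [J] and their coordinates outside [J]. *)
Lemma rainbow_grid_points (m N : nat) (c : {ffun 'I_m.+2 -> nat} -> 'I_m.+2) :
  exists (J : {set 'I_m.+2}) (b : 'I_m.+2 -> nat),
  [/\ \sum_j b j = N, forall j, j \notin J -> b j = 0 &
   forall k, k \in J -> exists a : {ffun 'I_m.+2 -> nat},
     [/\ \sum_j a j = N, c a = k & forall j, a j <= b j + m.+2 /\ b j <= a j + m.+2]].
Proof.
pose T : finType := {a : {ffun 'I_m.+2 -> 'I_N.+1} | \sum_j (a j : nat) == N}.
pose coord (t : T) : {ffun 'I_m.+2 -> nat} := [ffun j => val t j : nat].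
have sumT t : \sum_j coord t j = N.
  by rewrite -[RHS](eqP (valP t)); apply: eq_bigr => j _; rewrite ffunE.
have exT (g : 'I_m.+2 -> nat) : \sum_j g j = N -> exists t, coord t =1 g.
  move=> gN; have gl k : g k < N.+1 by rewrite ltnS -gN (bigD1 k) //= leq_addr.
  pose a : {ffun 'I_m.+2 -> 'I_N.+1} := [ffun j => inord (g j)].
  have aE k : a k = g k :> nat by rewrite ffunE inordK.
  have aN : \sum_j (a j : nat) == N by apply/eqP; rewrite -[RHS]gN; apply: eq_bigr => k _; exact: aE.
  by exists (exist _ a aN) => j; rewrite ffunE /= aE.
have [t0 _] : exists t, coord t =1 fun j => if j == ord0 then N else 0.
  by apply: exT; rewrite -big_mkcond big_pred1_eq.
(* The term enum_rank t only breaks ties between equal coordinates. *)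
pose v i (t : T) := coord t i * #|T| + enum_rank t.
have v_inj i : injective (v i).
  move=> t t' e; apply: enum_rank_inj; apply: val_inj => /=.
  by have := congr1 (modn^~ #|T|) e; rewrite !modnMDl !modn_small // ltn_ord.
have [s sP] := scarf t0 (c \o coord) v_inj.
have [i1 /imsetP[x0 x0s i1E] _] := sP t0.
have /fin_all_exists[mu muP] i : exists t, t \in s /\ forall x, x \in s -> coord t i <= coord x i.
  by case: (arg_minnP (fun t => coord t i) x0s) => t ts tmin; exists t.
pose f i := coord (mu i) i; pose J := (c \o coord) @: s.
have J0 : J != set0 by apply/set0Pn; exists i1; apply/imsetP; exists x0.
have fle x j : x \in s -> f j <= coord x j by case: (muP j) => _; apply.
have sumJ x : \sum_(j in J) coord x j <= N.
  by rewrite -(sumT x) [X in _ <= X](bigID (mem J)) leq_addr.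
have fN : \sum_(j in J) f j <= N.
  by apply: leq_trans (sumJ x0); apply: leq_sum => j _; apply: fle.
(* Otherwise f + 1 on J could be completed to a grid point contradicting sP. *)
have rJ : N - \sum_(j in J) f j < m.+2.
  rewrite ltnNge; apply/negP => lerJ.
  have cJ : \sum_(j in J) (f j).+1 <= N.
    under eq_bigr do rewrite -addn1.
    rewrite big_split /= sum1_card; have := max_card [in J]; rewrite card_ord => cJ.
    by apply: leq_trans (leq_add (leqnn _) cJ) _; rewrite -leq_subRL.
  have [g [gN _ gJ]] := fill_simplex J0 cJ; have [t tg] := exT g gN.
  have [i /gJ /andP[ig _]] := sP t => /(_ (mu i)); have [mus _] := muP i => /(_ mus).
  rewrite leqNgt /v tg => /negP; apply.
  apply: (@leq_trans ((f i).+1 * #|T|)); first by rewrite mulSnr ltn_add2l ltn_ord.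
  by rewrite (leq_trans _ (leq_addr _ _)) // leq_mul2r ig orbT.
have [b [bN b0 bJ]] := fill_simplex J0 fN; exists J, b; split => // k /imsetP[x xs ->].
exists (coord x); split => // j.
have [jJ|jJ] := boolP (j \in J).
  have close (A B F r M : nat) : F <= B -> B <= F + r -> F <= A -> A - F <= r -> r < M ->
      A <= B + M /\ B <= A + M by lia.
  have /andP[b1 b2] := bJ j jJ.
  apply: close b1 b2 (fle x j xs) _ rJ.
  (* The other coordinates of [x] in [J] are at least those of [f], so the excess at [j] is at most
     the whole deficit. *)
  have := sumJ x; rewrite (bigD1 j) //= [\sum_(j in J) f j](bigD1 j) //=.
  have : \sum_(i in J | i != j) f i <= \sum_(i in J | i != j) coord x i.
    by apply: leq_sum => i _; apply: fle.
  have arith (A F S1 SF M : nat) : SF <= S1 -> A + S1 <= M -> A - F <= M - (F + SF) by lia.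
  exact: arith.
rewrite b0 //; split=> //; rewrite add0n.
have sumf : \sum_(i in J) f i <= \sum_(i in J) coord x i.
  by apply: leq_sum => i _; apply: fle.
have := sumT x; rewrite (bigID (mem J)) /= [X in _ + X](bigD1 j) //= => sumx.
have arith (A SF S1 S2 M r : nat) : SF <= S1 -> S1 + (A + S2) = M -> M - SF < r -> A <= r by lia.
exact: arith sumf sumx rJ.
Qed.

(** * Fixed points in products of locally convex spaces *)

From mathcomp Require Import all_order all_algebra.
From mathcomp Require Import all_classical all_reals all_analysis.
From mathcomp Require Import lra.

Import Order.TTheory GRing.Theory Num.Theory.
Import numFieldNormedType.Exports.

Local Open Scope classical_set_scope.
Local Open Scope ring_scope.

(** * Convex combinations and neighbourhoods of 0 *)

Lemma convex_set_comb (K : numDomainType) (M : lmodType K) (A : set M) (x y : M) (t : K) :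
  @convex_set K M A -> A x -> A y -> 0 <= t <= 1 -> A (t *: x + (1 - t) *: y).
Proof.
move=> cA /mem_set Ax /mem_set Ay /andP[t0 t1].
exact: set_mem (cA x y (Itv01 t0 t1) Ax Ay).
Qed.

Lemma convex_setP (K : numDomainType) (M : lmodType K) (A : set M) :
  (forall x y t, A x -> A y -> 0 <= t <= 1 -> A (t *: x + (1 - t) *: y)) ->
  @convex_set K M A.
Proof.
move=> cA x y t /set_mem Ax /set_mem Ay; apply/mem_set.
by apply: (cA x y t%:inum) => //; rewrite ge0 le1.
Qed.

(** Induction, splitting off the first term and dividing the other weights by their sum [s].
    Membership is asked only where the weight is nonzero, because in an approximate fixed point only
    those terms are controlled. *)
Lemma convex_set_sum (K : numFieldType) (M : lmodType K) (A : set M) (n : nat)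
    (l : 'I_n -> K) (y : 'I_n -> M) :
  @convex_set K M A -> (forall i, 0 <= l i) -> \sum_i l i = 1 ->
  (forall i, l i != 0 -> A (y i)) -> A (\sum_i l i *: y i).
Proof.
move=> cA; elim: n l y => [|n IH] l y l0 l1 Ay.
  by move/eqP: l1; rewrite big_ord0 eq_sym oner_eq0.
rewrite big_ord_recl; move: l1; rewrite big_ord_recl.
set t := l ord0; set s := \sum_(i < n) _ => ts.
have s0 : 0 <= s by apply: sumr_ge0.
have [sE|sN0] := eqVneq s 0.
  have lE i : l (lift ord0 i) = 0.
    by move/eqP: sE; rewrite psumr_eq0 // => /allP/(_ i); rewrite mem_index_enum => /(_ isT)/eqP.
  rewrite big1 => [|i _]; last by rewrite lE scale0r.
  move: ts; rewrite sE addr0 => t1; rewrite t1 scale1r addr0.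
  by apply: Ay; rewrite -/t t1 oner_eq0.
have Az : A (\sum_(i < n) (l (lift ord0 i) / s) *: y (lift ord0 i)).
  apply: IH => [i||i ls0].
  - by rewrite divr_ge0.
  - by rewrite -mulr_suml divff.
  - by apply: Ay; apply: contraNneq ls0 => ->; rewrite mul0r.
have sE : s = 1 - t by rewrite -ts addrC addKr.
have zE : \sum_(i < n) l (lift ord0 i) *: y (lift ord0 i) =
    (1 - t) *: (\sum_(i < n) (l (lift ord0 i) / s) *: y (lift ord0 i)).
  rewrite -sE scaler_sumr; apply: eq_bigr => i _.
  by rewrite scalerA mulrCA divff ?mulr1.
rewrite zE; have [tE|tN0] := eqVneq t 0.
  by rewrite tE scale0r add0r subr0 scale1r.
apply: convex_set_comb => //; first exact: Ay.
by rewrite l0 -subr_ge0 -sE.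
Qed.

Lemma nbhs0_add (K : numFieldType) (M : tvsType K) (V : set M) : nbhs 0 V ->
  exists2 W : set M, nbhs 0 W & forall a b, W a -> W b -> V (a + b).
Proof.
move=> V0; have := @add_continuous M (0, 0) V; rewrite /= addr0 => /(_ V0).
case=> -[W1 W2] /= [W10 W20] W12; exists (W1 `&` W2); first exact: filterI.
by move=> a b [W1a _] [_ W2b]; apply: (W12 (a, b)).
Qed.

Lemma nbhs0_opp (K : numFieldType) (M : tvsType K) (V : set M) : nbhs 0 V ->
  nbhs 0 [set a | V (- a)].
Proof. by move=> V0; have := @opp_continuous M 0 V; rewrite /= oppr0; apply. Qed.

Lemma nbhs_sub (K : numFieldType) (M : tvsType K) (V : set M) (x : M) : nbhs 0 V ->
  \forall y \near x, V (y - x).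
Proof.
move=> V0; have : (fun y => y - x) @ x --> x - x.
  by apply: (@continuous_comp _ _ _ (fun y => (y, x)) (fun z : M * M => z.1 - z.2));
    [apply: cvg_pair; [exact: cvg_id|exact: cvg_cst]|exact: sub_continuous].
by apply; rewrite subrr.
Qed.

Lemma nbhs_shift (K : numFieldType) (M : tvsType K) (V : set M) (x : M) : nbhs x V ->
  \forall a \near (0 : M), V (x + a).
Proof.
move=> Vx; have : (fun a => x + a) @ (0 : M) --> x + 0.
  by apply: (@continuous_comp _ _ _ (fun y => (x, y)) (fun z : M * M => z.1 + z.2));
    [apply: cvg_pair; [exact: cvg_cst|exact: cvg_id]|exact: add_continuous].
by apply; rewrite addr0.
Qed.

Lemma nbhs0_convex (K : numFieldType) (M : tvsType K) (V : set M) : nbhs 0 V ->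
  exists W : set M, [/\ open W, W 0, @convex_set K M W & W `<=` V].
Proof.
move=> V0; have [B Bconv [Bopen Bbase]] := @locally_convex K M.
have [W [BW W0] WV] := Bbase 0 V V0.
by exists W; split => //; [exact: Bopen|apply: Bconv; exact: mem_set].
Qed.

(** Follows from continuity of scaling at 0, one term at a time; it turns closeness of grid
    coordinates into closeness of the points they represent. *)
Lemma nbhs0_linear_comb (K : realFieldType) (M : tvsType K) (n : nat) (y : 'I_n -> M) (V : set M) :
  nbhs 0 V -> exists2 e : K, 0 < e &
    forall t : 'I_n -> K, (forall j, `|t j| < e) -> V (\sum_j t j *: y j).
Proof.
elim: n y V => [|n IH] y V V0.
  by exists 1 => // t _; rewrite big_ord0; apply: nbhs_singleton.
have [W W0 WV] := nbhs0_add V0.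
have [e e0 eW] := IH (fun j => y (lift ord0 j)) W W0.
have : (fun t : K^o => t *: y ord0) @ (0 : K^o) --> (0 : K^o) *: y ord0.
  apply: (@continuous_comp K^o (K^o * M)%type M (fun t => (t, y ord0)) (fun z => z.1 *: z.2)).
    by apply: (@cvg_pair _ _ _ _ (nbhs (0 : K^o))); [exact: cvg_id|exact: cvg_cst].
  exact: scale_continuous.
rewrite scale0r => /(_ W W0) /nbhs_ballP [d /= d0 dW].
exists (Num.min d e); first by rewrite lt_min d0.
move=> t te; rewrite big_ord_recl; apply: WV.
  by apply: dW; rewrite -ball_normE /= sub0r normrN; have := te ord0; rewrite lt_min => /andP[].
by apply: eW => j; have := te (lift ord0 j); rewrite lt_min => /andP[].
Qed.

(** * The product topology and its compact boxes *)

Lemma cvg_prod_topology (I : eqType) (T : I -> topologicalType)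
    (F : set_system (prod_topology T)) (f : prod_topology T) :
  Filter F -> (forall i U, nbhs (f i) U -> F [set g | U (g i)]) -> F --> f.
Proof.
(* The product topology is the supremum of those induced by the projections; [dfwith] shows that
   each projection is onto. *)
move=> FF h; apply/cvg_sup => i; apply/cvg_image.
  by rewrite eqEsubset; split => // y _; exists (dfwith f i y) => //; rewrite dfwithin.
move=> U /h FU; exists [set g : prod_topology T | U (g i)] => //.
rewrite eqEsubset; split=> [_ [g Ug <-//]|y Uy].
by exists (dfwith f i y); rewrite /= dfwithin.
Qed.

(* Closeness is measured with neighbourhoods of 0 because the uniform structure
   of a tvsType is not required to be translation invariant. *)
Lemma nbhs_prod_tvs (K : numFieldType) (n : nat) (E : 'I_n -> tvsType K)
    (f : prod_topology E) (U : set (prod_topology E)) : nbhs f U ->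
  exists V : forall i, set (E i), (forall i, nbhs 0 (V i)) /\
    forall g, (forall i, V i (g i - f i)) -> U g.
Proof.
pose G := [set V : forall i, set (E i) | forall i, nbhs 0 (V i)].
pose Bs (V : forall i, set (E i)) := [set g : prod_topology E | forall i, V i (g i - f i)].
have FF : Filter (filter_from G Bs).
  apply: filter_from_filter; first by exists (fun=> setT) => i; exact: filterT.
  move=> V W V0 W0; exists (fun i => V i `&` W i); first by move=> i; apply: filterI.
  by move=> g h; split=> i; have [] := h i.
have Ff : filter_from G Bs --> f.
  apply: cvg_prod_topology => i U' U'f.
  have := nbhs_shift U'f => Ui.
  (* The neighbourhood coming from [U'] at the index [i], the whole space at any other; [ecast]
     identifies [E j] with [E i]. *)
  exists (fun j => [set a | forall e : j = i, U' (f i + ecast k (E k) e a)]).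
    move=> j; have [ji|/eqP ji] := eqVneq j i.
      by subst j; apply: filterS Ui => a Ua e; rewrite eq_axiomK.
    by apply: filterS filterT => a _ e; case: (ji e).
  by move=> g /(_ i)/(_ (erefl i)) /=; rewrite addrC subrK.
by move=> /Ff [V GV BV]; exists V; split.
Qed.

Lemma nbhs_proj (I : eqType) (T : I -> topologicalType) (f : prod_topology T) (i : I) (U : set (T i)) :
  nbhs (f i) U -> \forall g \near f, U (g i).
Proof. by move=> Uf; have := @proj_continuous I T i f U Uf. Qed.

(** Tychonoff's theorem in near-covering form, for the filter of finite lists of points ordered by
    inclusion: near each [f] any list containing [f] suffices, hence one list serves the whole
    product. *)
Lemma finite_cover_prod (K : numFieldType) (n : nat) (E : 'I_n -> tvsType K)
    (A W : forall i, set (E i)) (x0 : forall i, E i) :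
  (forall i, compact (A i)) -> (forall i, A i (x0 i)) -> (forall i, nbhs 0 (W i)) ->
  exists m (x : 'I_m.+2 -> forall i, E i), (forall k i, A i (x k i)) /\
    forall z : forall i, E i, (forall i, A i (z i)) -> exists k, forall i, W i (z i - x k i).
Proof.
move=> Acp Ax0 W0; pose T := prod_topology E.
pose X : set T := [set f | forall i, A i (f i)].
pose fam := [set s : seq T | forall f, f \in s -> X f].
pose tl (s : seq T) := [set s' : seq T | fam s' /\ {subset s <= s'}].
have FF : Filter (filter_from fam tl).
  apply: filter_from_filter; first by exists [::].
  move=> s s' Xs Xs'; exists (s ++ s').
    by move=> f; rewrite mem_cat => /orP[/Xs|/Xs'].
  move=> s'' [Xs'' sub]; split; split=> // f fs; apply: sub; rewrite mem_cat fs ?orbT //.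
have : near_covering X by apply/compact_near_coveringP; exact: tychonoff.
move=> /(_ _ _ (fun (s : seq T) z => exists2 f, f \in s & forall i, W i (z i - f i)) FF) [].
  move=> f Xf; exists ([set g | forall i, W i (g i - f i)], tl [:: f]); last first.
    by move=> [g s] /= [gW [_ fs]]; exists f => //; apply: fs; rewrite mem_head.
  split=> /=; last by exists [:: f] => // g; rewrite inE => /eqP ->.
  apply: (@filter_forall T _ (fun i (g : T) => W i (g i - f i)) (nbhs (f : T))) => i.
  by apply: (@nbhs_proj _ E f i [set a | W i (a - f i)]); apply: nbhs_sub.
move=> s Xs /(_ s) sP.
(* Two indices are added, with default point [x0], as Scarf's lemma is stated for at least two
   colours. *)
exists (size s), (fun k => nth (x0 : T) s k); split.
  move=> k; have [ks|ks] := ltnP k (size s); last by rewrite nth_default.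
  exact/Xs/mem_nth.
move=> z Xz; have [|f fs fz] := sP _ z Xz; first by split.
have fk : (index f s < (size s).+2)%N by rewrite ltnS ltnW // ltnS index_size.
by exists (Ordinal fk) => /=; rewrite nth_index.
Qed.

(** * Approximate and exact fixed points *)

Lemma approximate_fixed_point (K : realType) (n : nat) (E : 'I_n -> tvsType K)
    (A V : forall i, set (E i)) (G : forall i, (forall j, E j) -> set (E i)) :
  (forall i, A i !=set0) -> (forall i, compact (A i)) ->
  (forall i, @convex_set K (E i) (A i)) ->
  (forall i x, (forall j, A j (x j)) -> G i x !=set0 /\ G i x `<=` A i) ->
  (forall i, nbhs 0 (V i)) ->
  exists b : forall i, E i, (forall i, A i (b i)) /\
    exists m (l : 'I_m -> K) (x y : 'I_m -> forall i, E i),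
    [/\ forall k i, A i (x k i), forall k i, G i (x k) (y k i),
        (forall k, 0 <= l k) /\ \sum_k l k = 1,
        forall i, b i = \sum_k l k *: y k i &
        forall k, l k != 0 -> forall i, V i (x k i - b i)].
Proof.
move=> A0 Acp Acv GA V0.
pose x0 i : E i := projT1 (cid (A0 i)).
have Ax0 i : A i (x0 i) by rewrite /x0; case: cid.
have {}V0 i : exists W : set (E i), nbhs 0 W /\ forall a b, W a -> W b -> V i (a + b).
  by have [W] := nbhs0_add (V0 i); exists W.
pose W i := projT1 (cid (V0 i)).
have W0 i : nbhs 0 (W i) by rewrite /W; case: cid => ? [].
have WV i a b : W i a -> W i b -> V i (a + b).
  by rewrite /W; case: cid => ? [? /= h]; apply: h.
have [m [x [Ax xcover]]] := finite_cover_prod Acp Ax0 (fun i => nbhs0_opp (W0 i)).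
have G0 k i : exists z, G i (x k) z.
  by have [[z Gz] _] := GA i (x k) (Ax k); exists z.
pose y k i : E i := projT1 (cid (G0 k i)).
have Gy k i : G i (x k) (y k i) by rewrite /y; case: cid.
have Ay k i : A i (y k i) by have [_] := GA i (x k) (Ax k); apply; exact: Gy.
(* How fine the grid must be: coordinates that differ by at most [m.+2] give weights that differ by
   at most [m.+2 / N], which must move the combination by an element of [W i]. *)
have small i : exists N : nat, forall M : nat, (N <= M)%N -> forall t : 'I_m.+2 -> K,
    (forall j, `|t j| <= m.+2%:R / M%:R) -> W i (\sum_j t j *: y j i).
  have [e e0 eW] := nbhs0_linear_comb (y ^~ i) (W0 i).
  exists (Num.bound (m.+2%:R / e)) => M NM t tM; apply: eW => j.
  apply: le_lt_trans (tM j) _.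
  have hM : m.+2%:R / e < M%:R.
    apply: lt_le_trans (_ : (Num.bound (m.+2%:R / e))%:R <= _); last by rewrite ler_nat.
    by apply: archi_boundP; rewrite divr_ge0 // ltW.
  have M0 : 0 < M%:R :> K by apply: le_lt_trans hM; rewrite divr_ge0 // ltW.
  by rewrite ltr_pdivrMr // mulrC -ltr_pdivrMr.
pose Ni i := projT1 (cid (small i)).
pose N := (\max_i Ni i).+1.
have smallN i (t : 'I_m.+2 -> K) : (forall j, `|t j| <= m.+2%:R / N%:R) -> W i (\sum_j t j *: y j i).
  apply: (projT2 (cid (small i))); apply: leqW; exact: (leq_bigmax i).
have N0 : N%:R != 0 :> K by rewrite pnatr_eq0.
pose p (a : 'I_m.+2 -> nat) i : E i := \sum_j ((a j)%:R / N%:R) *: y j i.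
have sum1 (a : 'I_m.+2 -> nat) : (\sum_j a j)%N = N -> \sum_j (a j)%:R / N%:R = 1 :> K.
  by move=> aN; rewrite -mulr_suml -natr_sum aN divff.
have pA (a : 'I_m.+2 -> nat) : (\sum_j a j)%N = N -> forall i, A i (p a i).
  move=> aN i; apply: convex_set_sum => //; last exact: sum1.
(* The colour of a grid point [a] is the index of a point of the cover near [p a]; functions of
   another sum get the colour [ord0]. *)
have [c cP] : { c : {ffun 'I_m.+2 -> nat} -> 'I_m.+2 & forall a : {ffun 'I_m.+2 -> nat},
    (\sum_j a j)%N = N -> forall i, W i (x (c a) i - p a i) }.
  apply: (@choice _ _ (fun (a : {ffun 'I_m.+2 -> nat}) k =>
    (\sum_j a j)%N = N -> forall i, W i (x k i - p a i))) => a;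
  have [aN|aN] := pselect ((\sum_j a j)%N = N); last by exists ord0.
  by have [k kP] := xcover _ (pA a aN); exists k => _ i; have := kP i; rewrite /= opprB.
have [J [b [bN b0 bJ]]] := rainbow_grid_points N c.
exists (p b); split; first exact: pA.
exists m.+2, (fun j => (b j)%:R / N%:R), x, y; split => //; first by split => [k|]; [exact: divr_ge0|exact: sum1].
move=> k bk i.
have /bJ [a [aN ca ab]] : k \in J by apply: contraNT bk => /b0 ->; rewrite mul0r.
(* One [W] accounts for the cover, the other for the distance of the grid points [a] and [b]. *)
have -> : x k i - p b i = (x k i - p a i) + (p a i - p b i) by rewrite addrA subrK.
apply: WV; first by rewrite -ca; apply: cP.
rewrite /p -sumrB; under eq_bigr do rewrite -scalerBl -mulrBl.
apply: smallN => j; rewrite normrM [X in _ * X]ger0_norm ?invr_ge0 // ler_pM2r ?invr_gt0 ?ltr0n //.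
have [ab1 ab2] := ab j.
have r1 : (a j)%:R <= (b j)%:R + m.+2%:R :> K by rewrite -natrD ler_nat.
have r2 : (b j)%:R <= (a j)%:R + m.+2%:R :> K by rewrite -natrD ler_nat.
by rewrite ler_norml; apply/andP; split; lra.
Qed.

(** Without a fixed point, every [b] in the product would have a neighbourhood and a [V] that admit
    no approximate fixed point; compactness would give one [V] for the whole product, against
    [approximate_fixed_point]. The last hypothesis says that the graph of [G i] is closed in the
    product of the [A j] with [A i]. *)
Theorem product_fixed_point (K : realType) (n : nat) (E : 'I_n -> tvsType K)
    (A : forall i, set (E i)) (G : forall i, prod_topology E -> set (E i)) :
  (forall i, A i !=set0) -> (forall i, compact (A i)) ->
  (forall i, @convex_set K (E i) (A i)) ->
  (forall i x, (forall j, A j (x j)) ->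
    [/\ G i x !=set0, G i x `<=` A i & @convex_set K (E i) (G i x)]) ->
  (forall i (f : prod_topology E) z, (forall j, A j (f j)) -> A i z -> ~ G i f z ->
    \forall z' \near z & g \near f, (forall j, A j (g j)) -> ~ G i g z') ->
  exists b : prod_topology E, (forall j, A j (b j)) /\ forall i, G i b (b i).
Proof.
move=> A0 Acp Acv GP Gcl; apply: contrapT => nofix.
pose T := prod_topology E; pose X : set T := [set f | forall i, A i (f i)].
pose approx (V : forall i, set (E i)) (b : T) :=
  exists m (l : 'I_m -> K) (x y : 'I_m -> forall i, E i),
    [/\ forall k i, A i (x k i), forall k i, G i (x k) (y k i),
        (forall k, 0 <= l k) /\ \sum_k l k = 1,
        forall i, b i = \sum_k l k *: y k i &
        forall k, l k != 0 -> forall i, V i (x k i - b i)].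
pose N0 := [set V : forall i, set (E i) | forall i, nbhs 0 (V i)].
pose tl (V : forall i, set (E i)) := [set V' | N0 V' /\ forall i, V' i `<=` V i].
have FF : Filter (filter_from N0 tl).
  apply: filter_from_filter; first by exists (fun=> setT) => i; exact: filterT.
  move=> V W V0 W0; exists (fun i => V i `&` W i); first by move=> i; apply: filterI.
  by move=> U [U0 UVW]; split; split=> // i a /UVW [].
have ncX : near_covering X by apply/compact_near_coveringP; exact: tychonoff.
suff locno b : X b -> \forall b' \near b & V \near filter_from N0 tl, ~ approx V b'.
  have [V V0 Vno] := ncX _ _ (fun V b => ~ approx V b) FF locno.
  have [i x Xx|b [Xb bapprox]] := approximate_fixed_point (V := V) (G := G) A0 Acp Acv _ V0.
    by case: (GP i x Xx).
  have tV : tl V V by split => // i a.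
  exact: Vno tV b Xb bapprox.
move=> Xb.
have [i /= Gib] : exists i, ~ G i b (b i).
  by apply: contrapT => h; apply: nofix; exists b; split=> // i; apply: contrapT => ?; apply: h; exists i.
have [Gb0 GbA Gbcv] := GP i b Xb.
have [[A2 A1] /= [A2b A1b] Gno] := Gcl i b (b i) Xb (Xb i) Gib.
have [W1 W10 W1A] := nbhs0_add (nbhs_shift A2b).
have [W [Wop W0 Wcv WW1]] := nbhs0_convex (filterI W10 (nbhs0_opp W10)).
(* An open convex neighbourhood of [G i b], thin enough to miss all points [b i + u] with [u] in
   [W1]. *)
pose GW := [set z | exists2 g, G i b g & W (z - g)].
have GWb u : W1 u -> ~ GW (b i + u).
  move=> W1u [g Gg /WW1 [_ W1g]].
  apply: (Gno (g, b)) Gg; last exact: Xb.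
  split=> /=; last exact: nbhs_singleton.
  by have := W1A _ _ W1u W1g; rewrite opprB addrA [X in A2 X]addrC subrK.
have GW_open : open GW.
  rewrite openE => z0 [g Gg Wz]; have /nbhs_sub := nbhs_shift (open_nbhs_nbhs (conj Wop Wz)).
  move=> /(_ z0); apply: filterS => z /= Wz'; exists g => //.
  by move: Wz'; rewrite addrC addrA subrK.
have GW_convex : @convex_set K (E i) GW.
  apply: convex_setP => z z' t [g Gg Wz] [g' Gg' Wz'] t01.
  exists (t *: g + (1 - t) *: g'); first exact: convex_set_comb.
  rewrite opprD addrACA -!scalerBr; exact: convex_set_comb.
have ncGW : near_covering (A i `&` ~` GW).
  by apply/compact_near_coveringP/compact_closedI => //; exact: open_closedC.
have away z : (A i `&` ~` GW) z ->
    \forall z' \near z & g \near b, (forall j, A j (g j)) -> ~ G i g z'.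
  by move=> [Az GWz]; apply: Gcl => // Gz; apply: GWz; exists z; rewrite ?subrr.
(* Upper semicontinuity: by compactness of the part of [A i] outside [GW], the values [G i g] lie in
   [GW] for [g] near [b]. *)
have Ub := ncGW _ _ (fun g z => (forall j, A j (g j)) -> ~ G i g z) (nbhs_filter b) away.
have [V0 [V00 V0U]] := nbhs_prod_tvs Ub.
have {}V00 j : exists W : set (E j), nbhs 0 W /\ forall a b, W a -> W b -> V0 j (a + b).
  by have [W'] := nbhs0_add (V00 j); exists W'.
pose V2 j := projT1 (cid (V00 j)).
have V20 j : nbhs 0 (V2 j) by rewrite /V2; case: cid => ? [].
have V2V j a a' : V2 j a -> V2 j a' -> V0 j (a + a').
  by rewrite /V2; case: cid => ? [? /= h]; apply: h.
exists ([set g : T | (forall j, V2 j (g j - b j)) /\ W1 (g i - b i)], tl V2).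
  split=> /=; last by exists V2.
  apply: filterI; last by apply: (@nbhs_proj _ E b i [set a | W1 (a - b i)]); apply: nbhs_sub.
  apply: (@filter_forall T _ (fun j (g : T) => V2 j (g j - b j)) (nbhs b)) => j.
  by apply: (@nbhs_proj _ E b j [set a | V2 j (a - b j)]); apply: nbhs_sub.
move=> [b' V] /= [[b'V2 b'W1] [_ VV2]] [m [l [x [y [Ax Gy [l0 l1] b'E close]]]]].
(* The [x k] of nonzero weight are near [b'], hence near [b], so their [y k i] lie in [GW]; by
   convexity so does [b' i], which is too close to [b i] for that. *)
have := GWb _ b'W1; rewrite addrC subrK b'E; apply.
apply: convex_set_sum => // k lk; apply: contrapT => nGW.
have := V0U (x k); apply.
- move=> j; rewrite -(subrK (b' j) (x k j)) -addrA; apply: V2V => //.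
  exact/VV2/close.
- split; last exact: nGW.
  by have [_ GA _] := GP i _ (Ax k); apply: GA.
- exact: Ax.
- exact: Gy.
Qed.

(** * Existence of a solution of the system *)

Theorem theorem2 (K : realType) (n : nat) (E : 'I_n -> tvsType K)
    (hausdorffE : forall i, hausdorff_space (E i))
    (X_ : forall i, set (E i))
    (X_neq0 : forall i, X_ i !=set0)
    (X_compact : forall i, compact (X_ i))
    (X_convex : forall i, convex_set (X_ i))
    (X : set (prod_topology E))
    (XE : X = [set x | forall i, X_ i (x i)])
    (S Q : forall i, prod_topology E -> set (E i))
    (S_neq0 : forall i x, X x -> S i x !=set0)
    (S_sub : forall i x, X x -> S i x `<=` X_ i)
    (Q_neq0 : forall i x, X x -> Q i x !=set0)
    (Q_sub : forall i x, X x -> Q i x `<=` X_ i)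
    (R : forall i, prod_topology E -> E i -> Prop)
    (H1 : forall i (x : prod_topology E),
      (forall j, j != i -> X_ j (x j)) ->
      exists xi : E i, [/\ X_ i xi, S i (dfwith x i xi) xi &
        forall y, Q i (dfwith x i xi) y -> R i (dfwith x i xi) y])
    (H2 : forall i (x : prod_topology E),
      (forall j, j != i -> X_ j (x j)) ->
      convex_set [set z | X_ i z /\ S i (dfwith x i z) z])
    (H3 : forall i (x : prod_topology E),
      (forall j, j != i -> X_ j (x j)) ->
      forall (l : nat) (zs : 'I_l -> E i),
      (forall k, X_ i (zs k)) ->
      (forall k t, Q i (dfwith x i (zs k)) t -> R i (dfwith x i (zs k)) t) ->
      forall z, convex_hull (range zs) z ->
      forall theta, Q i (dfwith x i z) theta -> R i (dfwith x i z) theta)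
    (H4 : forall i (A : Type) (le : A -> A -> Prop)
        (x : A -> prod_topology E) (x0 : prod_topology E),
      directed_set le -> (forall a, X (x a)) -> X x0 ->
      x @ tails le --> x0 ->
      (forall a, S i (x a) (x a i)) -> S i x0 (x0 i))
    (H5 : forall i (A : Type) (le : A -> A -> Prop)
        (x : A -> prod_topology E) (x0 : prod_topology E),
      directed_set le -> (forall a, X (x a)) -> X x0 ->
      x @ tails le --> x0 ->
      (forall a t, Q i (x a) t -> R i (x a) t) ->
      forall theta, Q i x0 theta -> R i x0 theta) :
  exists x : prod_topology E, X x /\
    forall i, S i x (x i) /\ (forall y, Q i x y -> R i x y).
Proof.
pose T := prod_topology E.
(* [G i x] does not depend on [x i]; any [b] with [G i b (b i)] for every [i] is a solution. *)
pose G i (x : T) : set (E i) := [set z | [/\ X_ i z, S i (dfwith x i z) z &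
  forall y, Q i (dfwith x i z) y -> R i (dfwith x i z) y]].
have Xdf i (x : T) z : (forall j, X_ j (x j)) -> X_ i z -> X (dfwith x i z).
  by move=> Xx Xz; rewrite XE /= => j; case: dfwithP.
have GP i (x : T) : (forall j, X_ j (x j)) ->
    [/\ G i x !=set0, G i x `<=` X_ i & @convex_set K (E i) (G i x)].
  move=> Xx; have Xx' j : j != i -> X_ j (x j) by [].
  split; first exact: H1.
    by move=> z [].
  apply: convex_setP => z z' t [Xz Sz Rz] [Xz' Sz' Rz'] t01.
  have [Xw Sw] := convex_set_comb (H2 i x Xx') (conj Xz Sz) (conj Xz' Sz') t01.
  split=> // y.
  apply: (H3 i x Xx' 2%N (fun k => if k == ord0 then z else z')).
  - by move=> k; case: ifP.
  - by move=> k; case: ifP.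
  - move=> M [cM sM]; apply: convex_set_comb => //; apply: sM.
      by exists ord0.
    by exists (lift ord0 ord0).
have Gcl i (f : T) z : (forall j, X_ j (f j)) -> X_ i z -> ~ G i f z ->
    \forall z' \near z & g \near f, (forall j, X_ j (g j)) -> ~ G i g z'.
  move=> Xf Xz nG; apply: contrapT => nnear; apply: nG.
  have meet (D : set (E i * T)) : nbhs (z, f) D ->
      exists p, [/\ D p, forall j, X_ j (p.2 j) & G i p.2 p.1].
    move=> Df; apply: contrapT => no; apply: nnear; apply: filterS Df => -[z' g] Og Xg Gg.
    by apply: no; exists (z', g).
  (* The net of all points of the graph of G i, indexed together with the
     neighbourhoods of (z, f) that contain them. *)
  pose N := {q : set (E i * T) * (E i * T) |
    [/\ nbhs (z, f) q.1, q.1 q.2, forall j, X_ j (q.2.2 j) & G i q.2.2 q.2.1]}.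
  pose le (a b : N) := (sval b).1 `<=` (sval a).1.
  have exN (D : set (E i * T)) : nbhs (z, f) D -> exists a : N, (sval a).1 = D.
    move=> Df; have [p [Op Xp Gp]] := meet D Df.
    have h : [/\ nbhs (z, f) (D, p).1, (D, p).1 (D, p).2,
      forall j, X_ j ((D, p).2.2 j) & G i (D, p).2.2 (D, p).2.1] by [].
    by exists (exist _ (D, p) h).
  have dir : directed_set le.
    split.
    - by have [a _] := exN setT filterT; exact: (inhabits a).
    - by move=> a.
    - by move=> a b c ab bc u /bc /ab.
    - move=> [[D p] /= [Df ? ? ?]] [[D' p'] /= [D'f ? ? ?]].
      by have [c cE] := exN _ (filterI Df D'f); exists c; rewrite /le cE /=; split=> u [].
  (* With [z'] put in position [i] of [g], membership in [G i g] becomes a condition on a single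
     point, as (H4) and (H5) require. *)
  pose net (a : N) : T := dfwith (sval a).2.2 i (sval a).2.1.
  have Xnet a : X (net a) by have [_ _ Xg [Xz' _ _]] := svalP a; apply: Xdf.
  have Xlim : X (dfwith f i z) by apply: Xdf.
  have tF : Filter (tails le).
    apply: filter_from_filter; first by have [a _] := exN setT filterT; exists a.
    move=> a b _ _; have [c [ac bc]] := directed_ub dir a b.
    by exists c => // d cd; split; apply: (directed_trans dir) cd.
  have net_cvg : net @ tails le --> (dfwith f i z : T).
    apply: cvg_prod_topology => j U Uf.
    (* This neighbourhood of [(z, f)] is the index of a tail on which coordinate [j] of the net
       stays in [U]. *)
    have : \forall z' \near z & g \near f, U (dfwith g i z' j).
      have [ij|ij] := eqVneq i j.
        subst j; exists (U, setT) => [|[z' g] /= [Uz' _]]; last by rewrite dfwithin.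
        by split; [move: Uf; rewrite dfwithin|exact: filterT].
      exists (setT, [set g : T | U (g j)]) => [|[z' g] /= [_ Ug]]; last by rewrite dfwithout.
      split; first exact: filterT.
      by apply: nbhs_proj; move: Uf; rewrite dfwithout.
    move=> /exN [a aE]; exists a => // b ab; rewrite /= /net.
    by have [_ Db _ _] := svalP b; have := ab _ Db; rewrite aE.
  have Gnet a : S i (net a) (net a i) /\ forall t, Q i (net a) t -> R i (net a) t.
    by have [_ _ _ [_ Sa Ra]] := svalP a; rewrite /net dfwithin.
  split=> //.
    have := H4 i N le net _ dir Xnet Xlim net_cvg (fun a => (Gnet a).1).
    by rewrite dfwithin.
  by apply: (H5 i N le net _ dir Xnet Xlim net_cvg) => a; have [] := Gnet a.
have [b [Xb Gb]] := product_fixed_point X_neq0 X_compact X_convex GP Gcl.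
exists b; split; first by rewrite XE.
move=> i; have [_ Sb Rb] := Gb i.
have bE : dfwith b i (b i) = b :> T by apply: functional_extensionality_dep => j; case: dfwithP.
by rewrite bE in Sb Rb.
Qed.
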